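(* Let $k$ be an algebraically closed field of characteristic $3$. There are no unexpected cubic curves in $\mathbb{P}^2_k$ coming from any quasi-elliptic fibration of the types (i)--(vii) listed in the context. That is, there is no set $Z$ of seven (not necessarily distinct) points of $\mathbb{P}^2_k$ such that $Z$ admits an unexpected cubic and such that, for a general point $P\in\mathbb{P}^2_k$, the quasi-elliptic fibration determined by the pencil of cubics containing $Z\cup\{P\}$, which is the blow-up of $\mathbb{P}^2_k$ at the seven points of $Z$, the point $P$ and a point infinitely near $P$, is of one of the types (i)--(vii).
   Context: Points. A set of not necessarily distinct points $Z=\{P_1,\dots,P_r\}$ of $\mathbb{P}^2_k$ means: $P_1\in X_0=\mathbb{P}^2_k$, and $P_{i+1}\in X_i$, where $X_i\to X_{i-1}$ is the blow-up at $P_i$; so some points may be infinitely near to others ($Q$ is infinitely near to $P$ if $Q$ maps to $P$ under the blow-up at $P$). On $X_r$, let $\ell$ be the pullback class of a line and $e_i$ the class of the total transform of the exceptional curve of the blow-up at $P_i$. A plane curve of degree $t$ contains $Z$ if its pullback to $X_r$ minus the sum of these total transforms is effective; $h^0(\mathbb{P}^2_k, I_Z(t))=h^0(X_r,t\ell-e_1-\cdots-e_r)$ is the dimension of the space of degree $t$ forms vanishing on $Z$, and $h^0(\mathbb{P}^2_k, I_{Z+dP}(t))$ is the dimension of the subspace of those also having multiplicity at least $d$ at the point $P$. (For distinct points, $I_{Z+dP}=\bigcap_{q\in Z}I(q)\cap I(P)^d$.) Unexpected curves. $Z$ admits an unexpected curve of degree $d+1$ if, for a general point $P\in\mathbb{P}^2_k$,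 $$h^0\left(\mathbb{P}^2_k,I_{Z+dP}(d+1)\right)>\max\left(0,\ h^0\left(\mathbb{P}^2_k,I_Z(d+1)\right)-\binom{d+1}{2}\right).$$ An unexpected cubic is the case $d=2$. Quasi-elliptic fibrations. A quasi-elliptic fibration is a smooth projective surface $X$ with a morphism $X\to\mathbb{P}^1_k$ whose general fiber is isomorphic to a singular plane cubic curve. Those considered are blow-ups $X$ of $\mathbb{P}^2_k$ at nine possibly infinitely near points, with $\operatorname{Pic}X=\langle \ell,e_1,\dots,e_9\rangle$, where $\ell$ is the pullback to $X$ of the class of a line in $\mathbb{P}^2_k$ and $e_i$ is the class of the total transform on $X$ of the exceptional curve of the blow-up at the $i$-th of the nine points, and $K=-3\ell+e_1+\cdots+e_9$ the canonical class. The types are as follows: a quasi-elliptic fibration given as a blow-up of $\mathbb{P}^2_k$ at nine points is of a given type if, for a suitable ordering of the nine blown-up points, the classes of the irreducible curves on $X$ of self-intersection $-2$ are exactly those listed. Abbreviate $\ell-e_a-e_b-e_c$ as $\ell-abc$ and $2\ell-e_a-e_b-e_c-e_d-e_f-e_g$ as $2\ell-abcdfg$. (i) ($\widetilde{A}_2^{\oplus4}$): $\ell-123,\ \ell-456,\ \ell-789;\ \ell-147,\ \ell-258,\ \ell-369;\ \ell-159,\ \ell-267,\ \ell-348;\ \ell-168,\ \ell-249,\ \ell-357$. (ii) ($\widetilde{A}_2^{\oplus4}$): $e_1-e_2,\ 2\ell-156789,\ \ell-134;\ 2\ell-123789,\ e_3-e_4,\ \ell-356;\ \ell-125,\ e_5-e_6,\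 2\ell-345789;\ -K-e_7+e_9,\ e_8-e_9,\ e_7-e_8$. (iii) ($\widetilde{A}_2^{\oplus4}$): $e_2-e_3,\ -K-e_1+e_3,\ e_1-e_2;\ -K-e_7+e_9,\ e_7-e_8,\ e_8-e_9;\ \ell-123,\ \ell-789,\ \ell-456;\ -K-e_4+e_6,\ e_5-e_6,\ e_4-e_5$. (iv) ($\widetilde{A}_2\oplus\widetilde{E}_6$): $\ell-123,\ \ell-456,\ \ell-789;\ e_2-e_3,\ e_1-e_2,\ \ell-147,\ e_7-e_8,\ e_8-e_9,\ e_4-e_5,\ e_5-e_6$. (v) ($\widetilde{A}_2\oplus\widetilde{E}_6$): $e_7-e_8,\ e_8-e_9,\ -K-e_7+e_9;\ e_1-e_2,\ e_2-e_3,\ e_3-e_4,\ \ell-123,\ \ell-789,\ e_4-e_5,\ e_5-e_6$. (vi) ($\widetilde{A}_2\oplus\widetilde{E}_6$): $2\ell-123456,\ \ell-689,\ e_6-e_7;\ e_4-e_5,\ e_3-e_4,\ e_2-e_3,\ \ell-128,\ e_8-e_9,\ e_1-e_2,\ \ell-167$. (vii) ($\widetilde{E}_8$): $e_i-e_{i+1}$ for $1\le i\le 8$, and $\ell-123$. *)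

(* Defs.v *)
From HB Require Import structures.
From mathcomp Require Import all_boot all_order all_algebra.
From mathcomp Require Import mpoly.

Set Implicit Arguments.
Unset Strict Implicit.
Unset Printing Implicit Defensive.

Import Order.TTheory GRing.Theory Num.Theory.
Local Open Scope ring_scope.

Section Plane.
Variable k : fieldType.

(* The index of the first nonzero coordinate (ord0 for the zero vector). *)
Definition pivot (v : 'rV[k]_3) : 'I_3 :=
  odflt ord0 [pick i | (v 0 i != 0) && [forall j : 'I_3, (j < i)%N ==> (v 0 j == 0)]].

(* A point of P^2 is represented by its unique homogeneous coordinate vector
   whose first nonzero coordinate is 1. *)
Definition P2 := {v : 'rV[k]_3 | v 0 (pivot v) == 1}.

(* Closed points of the surfaces obtained from P^2 by blowing up points: a
   point of P^2, or a point of the exceptional curve of the blow-up at [x].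
   The latter are the tangent directions at [x], in the local coordinates
   (u, v) fixed by the charts below: [Some a] is the direction v = a u and
   [None] is u = 0.  A point keeps its name when other points are blown up. *)
Inductive bubble := Proper of P2 | Near of bubble & option k.

Fixpoint bubble_code (x : bubble) : P2 * seq (option k) :=
  match x with
  | Proper p => (p, [::])
  | Near y c => let q := bubble_code y in (q.1, c :: q.2)
  end.

Definition bubble_decode (q : P2 * seq (option k)) : bubble :=
  foldr (fun c y => Near y c) (Proper q.1) q.2.

Lemma bubble_codeK : cancel bubble_code bubble_decode.
Proof. by elim=> [//|y IH c] /=; rewrite -[in RHS]IH. Qed.

HB.instance Definition _ := Equality.copy bubble (can_type bubble_codeK).

(* [on_blowup s x]: x is a point of the surface obtained by blowing up [s]. *)
Definition on_blowup (s : seq bubble) (x : bubble) : bool :=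
  (x \notin s) && (if x is Near y _ then y \in s else true).

(* P_{i+1} lies on X_i, the blow-up of P^2 at P_1, ..., P_i. *)
Definition centers n (s : n.-tuple bubble) : Prop :=
  forall i : 'I_n, on_blowup (take i s) (tnth s i).

(* The chart (u, v) |-> p + u e_j + v e_l, where j < l are the indices other
   than the pivot of p; it identifies A^2 with an affine plane of P^2. *)
Definition affine_chart (p : P2) : 3.-tuple {mpoly k[2]} :=
  [tuple (val p 0 i)%:MP
         + (if unlift (pivot (val p)) i is Some r then 'X_r else 0) | i < 3].

(* The chart of the blow-up of A^2 at the origin centred at the direction c,
   and an equation of the exceptional curve in that chart. *)
Definition blowup_chart (c : option k) : 2.-tuple {mpoly k[2]} :=
  if c is Some a then [tuple 'X_ord0; 'X_ord0 * ('X_ord_max + a%:MP)]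
  else [tuple 'X_ord0 * 'X_ord_max; 'X_ord_max].

Definition exc_var (c : option k) : 'I_2 := if c is Some _ then ord0 else ord_max.

(* Multiplicity at the origin of a nonzero polynomial: [mlast p] is the
   smallest monomial of p for the degrevlex order, hence one of least degree.
   (This is 0, not infinity, for p = 0.) *)
Definition mult (p : {mpoly k[2]}) : nat := mdeg (mlast p).

Definition div_var (i : 'I_2) (n : nat) (p : {mpoly k[2]}) : {mpoly k[2]} :=
  \sum_(m <- msupp p) p@_m *: 'X_[m - U_(i) *+ n].

Definition total_step (c : option k) (f : {mpoly k[2]}) : {mpoly k[2]} :=
  f \mPo blowup_chart c.

Definition strict_step (c : option k) (f : {mpoly k[2]}) : {mpoly k[2]} :=
  div_var (exc_var c) (mult f) (total_step c f).

(* Local equations at x, in the coordinates (u, v) centred at x, of the total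
   and of the strict transform of the plane curve F = 0. *)
Fixpoint total (F : {mpoly k[3]}) (x : bubble) : {mpoly k[2]} :=
  match x with
  | Proper p => F \mPo affine_chart p
  | Near y c => total_step c (total F y)
  end.

Fixpoint strict (F : {mpoly k[3]}) (x : bubble) : {mpoly k[2]} :=
  match x with
  | Proper p => F \mPo affine_chart p
  | Near y c => strict_step c (strict F y)
  end.

(* The same for the exceptional curve of the blow-up at b (equation 1 at the
   points x that do not lie over b). *)
Fixpoint total_exc (b x : bubble) : {mpoly k[2]} :=
  match x with
  | Proper _ => 1
  | Near y c => if y == b then 'X_(exc_var c) else total_step c (total_exc b y)
  end.

Fixpoint strict_exc (b x : bubble) : {mpoly k[2]} :=
  match x with
  | Proper _ => 1
  | Near y c => if y == b then 'X_(exc_var c) else strict_step c (strict_exc b y)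
  end.

Notation form t := (dhomog 3 k t).

(* Forms of degree t whose total transform has multiplicity >= c at x. *)
Definition mult_ge_forms (t : nat) (x : bubble) (c : nat) : {vspace form t} :=
  (\bigcap_(m : 'X_{1..2 < c})
     lker (linfun (fun F : form t => (total F x)@_m : k^o)))%VS.

Lemma total_is_linear t x (m : 'X_{1..2}) :
  linear (fun F : form t => (total F x)@_m : k^o).
Proof.
suff H c (F G : {mpoly k[3]}) : total (c *: F + G) x = c *: total F x + total G x.
  by move=> c F G; rewrite /= H mcoeffD mcoeffZ.
by elim: x => [p|y IH d] /=; rewrite ?IH /total_step comp_mpolyD comp_mpolyZ.
Qed.

Lemma mem_mult_ge_forms t x c (F : form t) :
  reflect (forall m : 'X_{1..2}, (mdeg m < c)%N -> (total F x)@_m = 0)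
          (F \in mult_ge_forms t x c).
Proof.
have E (m : 'X_{1..2}) :
    (F \in lker (linfun (fun F : form t => (total F x)@_m : k^o)))
      = ((total F x)@_m == 0).
  pose h := GRing.isLinear.Build _ _ _ _ _ (@total_is_linear t x m).
  pose l : {linear form t -> k^o} := HB.pack (fun F : form t => (total F x)@_m : k^o) h.
  by rewrite memv_ker (lfunE l).
rewrite /mult_ge_forms memvE.
apply: (iffP subv_bigcapP) => [H m mc|H m _].
  by apply/eqP; rewrite -E memvE (H (BMultinom mc)).
by rewrite -memvE E; apply/eqP/H/bmdeg.
Qed.

(* Multiplicity at P_j is the order of vanishing along the exceptional curve
   of the blow-up at P_j.  Pulling F back to X_n and subtracting the total
   transforms e_1, ..., e_n therefore leaves an effective divisor iff at each
   P_j the total transform of F has multiplicity at least the sum over i of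
   the order of e_i along that curve, which is 1 for i = j. *)
Definition containing n (s : n.-tuple bubble) (t : nat) : {vspace form t} :=
  (\bigcap_(j < n)
     mult_ge_forms t (tnth s j)
       (\sum_(i < n) ((i == j) + mult (total_exc (tnth s i) (tnth s j)))))%VS.

(* "For a general point of P^2": on a nonempty Zariski open set; the principal
   ones, G != 0, form a basis of the topology. *)
Definition general (Q : P2 -> Prop) : Prop :=
  exists d, exists2 G : form d,
    G != 0 & forall p : P2, G.@[fun i => val p 0 i] != 0 -> Q p.

Definition admits_unexpected n (s : n.-tuple bubble) (d : nat) : Prop :=
  general (fun p =>
    Num.max 0 ((\dim (containing s d.+1))%:Z - 'C(d.+1, 2)%:Z)
      < (\dim (containing s d.+1 :&: mult_ge_forms d.+1 (Proper p) d)%VS)%:Z).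

(* Pic of the blow-up at n points: (t, m) stands for t l + sum_i m_i e_i. *)
Definition Pic n : zmodType := (int * 'rV[int]_n)%type.
Definition ell n : Pic n := (1, 0).
Definition exc n (i : 'I_n) : Pic n := (0, delta_mx 0 i).
Definition antican n : Pic n := ell n *+ 3 - \sum_(i < n) exc i.
Definition selfint n (D : Pic n) : int := D.1 ^+ 2 - \sum_(i < n) D.2 0 i ^+ 2.

(* Classes of the strict transforms of the plane curve F = 0 and of the
   exceptional curve of the blow-up at the j-th point. *)
Definition plane_class n (s : n.-tuple bubble) t (F : form t) : Pic n :=
  ell n *+ t - \sum_(i < n) exc i *+ mult (strict F (tnth s i)).

Definition exc_class n (s : n.-tuple bubble) (j : 'I_n) : Pic n :=
  exc j - \sum_(i < n) exc i *+ mult (strict_exc (tnth s j) (tnth s i)).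

Definition irreducible_mpoly (F : {mpoly k[3]}) : Prop :=
  [/\ F != 0, F \isn't a GRing.unit &
      forall G H : {mpoly k[3]}, F = G * H ->
        G \is a GRing.unit \/ H \is a GRing.unit].

Definition minus_two_class n (s : n.-tuple bubble) (D : Pic n) : Prop :=
  ((exists t, exists2 F : form t, irreducible_mpoly F & D = plane_class s F)
     \/ (exists j, D = exc_class s j))
  /\ selfint D = -2.

Definition singular t (F : form t) : Prop :=
  F != 0 /\ exists p : P2, (2 <= mult (total F (Proper p)))%N.

(* The pencil V of cubics defines a morphism X -> P^1 on the blow-up X at the
   nine points s: its members minus e_1 + ... + e_9 are effective and have no
   common point on X.  The fibres are these divisors, all of class
   3 l - e_1 - ... - e_9.  A general fibre is the strict transform of a member
   F of V which has multiplicity exactly 1 at each of the nine points; it is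
   then mapped isomorphically to the plane cubic F = 0, which is singular.
   "General" means outside finitely many members of the pencil. *)
Definition quasi_elliptic (s : 9.-tuple bubble) (V : {vspace form 3}) : Prop :=
  [/\ centers s,
      \dim V = 2%N,
      (V <= containing s 3)%VS,
      forall x : bubble, on_blowup s x ->
        exists2 F : form 3, F \in V &
          exists2 g : {mpoly k[2]},
            total F x = g * \prod_(i < 9) total_exc (tnth s i) x & g@_0%MM != 0
    & exists B : seq (form 3), forall F : form 3,
        F \in V -> F != 0 -> (forall G, G \in B -> F \notin <[G]>%VS) ->
        plane_class s F = antican 9 /\ singular F].

Definition has_type (s : 9.-tuple bubble) (T : seq (Pic 9)) : Prop :=
  exists s' : 9.-tuple bubble,
    [/\ perm_eq s' s, centers s'
      & forall D : Pic 9, minus_two_class s' D <-> D \in T].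

End Plane.

Local Notation l := (ell 9).
Local Notation mK := (antican 9).
Local Notation e a := (exc (inord (a%N.-1) : 'I_9)).
Local Notation L a b c := (l - e a - e b - e c).
Local Notation C a b c d f g := (l *+ 2 - e a - e b - e c - e d - e f - e g).

Definition type_i : seq (Pic 9) :=
  [:: L 1 2 3; L 4 5 6; L 7 8 9;
      L 1 4 7; L 2 5 8; L 3 6 9;
      L 1 5 9; L 2 6 7; L 3 4 8;
      L 1 6 8; L 2 4 9; L 3 5 7].

Definition type_ii : seq (Pic 9) :=
  [:: e 1 - e 2; C 1 5 6 7 8 9; L 1 3 4;
      C 1 2 3 7 8 9; e 3 - e 4; L 3 5 6;
      L 1 2 5; e 5 - e 6; C 3 4 5 7 8 9;
      mK - e 7 + e 9; e 8 - e 9; e 7 - e 8].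

Definition type_iii : seq (Pic 9) :=
  [:: e 2 - e 3; mK - e 1 + e 3; e 1 - e 2;
      mK - e 7 + e 9; e 7 - e 8; e 8 - e 9;
      L 1 2 3; L 7 8 9; L 4 5 6;
      mK - e 4 + e 6; e 5 - e 6; e 4 - e 5].

Definition type_iv : seq (Pic 9) :=
  [:: L 1 2 3; L 4 5 6; L 7 8 9;
      e 2 - e 3; e 1 - e 2; L 1 4 7; e 7 - e 8; e 8 - e 9; e 4 - e 5; e 5 - e 6].

Definition type_v : seq (Pic 9) :=
  [:: e 7 - e 8; e 8 - e 9; mK - e 7 + e 9;
      e 1 - e 2; e 2 - e 3; e 3 - e 4; L 1 2 3; L 7 8 9; e 4 - e 5; e 5 - e 6].

Definition type_vi : seq (Pic 9) :=
  [:: C 1 2 3 4 5 6; L 6 8 9; e 6 - e 7;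
      e 4 - e 5; e 3 - e 4; e 2 - e 3; L 1 2 8; e 8 - e 9; e 1 - e 2; L 1 6 7].

Definition type_vii : seq (Pic 9) :=
  [:: e 1 - e 2; e 2 - e 3; e 3 - e 4; e 4 - e 5;
      e 5 - e 6; e 6 - e 7; e 7 - e 8; e 8 - e 9; L 1 2 3].

Definition quasi_elliptic_types : seq (seq (Pic 9)) :=
  [:: type_i; type_ii; type_iii; type_iv; type_v; type_vi; type_vii].

(* Main.v *)
(* The exceptional curve over P has class e_a - e_b, where a is the index of P and
   b that of the point infinitely near P, so this class occurs in the list of the
   type. No (-2)-curve of class e_c - e_a or e_b - e_c exists, since P is a proper
   point of the plane and no point of Z lies over P. The types (i), (iii), (iv), (v)
   and (vii) contain no class e_a - e_b with this property; for (ii) and (vi) the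
   list then contains some e_i - e_j and the class of a line through the points a,
   i, j. As j is infinitely near i, that line is determined by the point j of Z
   alone, so P lies on one of at most seven lines depending only on Z. *)
Require Import Defs.
From mathcomp Require Import all_boot all_order all_algebra.
From mathcomp Require Import mpoly ring.

Set Implicit Arguments.
Unset Strict Implicit.
Unset Printing Implicit Defensive.

Import Order.TTheory GRing.Theory Num.Theory.
Local Open Scope ring_scope.

(** * Nonvanishing of polynomials *)

Section Meval.

Local Notation widen := (widen_ord (leqnSn _)).

(** A monomial [m] is determined by its exponent in the last variable and its restriction to the
    others, so [muni p] still shows each coefficient of [p] separately. *)
Lemma muni_eq0 (R : nzRingType) n (p : {mpoly R[n.+1]}) : (muni p == 0) = (p == 0).
Proof.
apply/eqP/eqP => [p0|->]; last exact: muni0.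
apply/mpolyP => m; rewrite mcoeff0.
have /(congr1 (mcoeff [multinom m (widen i) | i < n])) :
  (muni p)`_(m ord_max) = 0 by rewrite p0 coef0.
rewrite mcoeff0 muniE coef_sum raddf_sum /= => pm0.
rewrite -[RHS]pm0 [in LHS](mpolyE p) raddf_sum /=; apply: eq_bigr => q _.
rewrite coefZ coefXn mcoeffZ mcoeffX.
have -> : (q == m) = (m ord_max == q ord_max)
    && ([multinom q (widen i) | i < n] == [multinom m (widen i) | i < n]).
  apply/eqP/andP => [-> //|[/eqP qm /eqP/mnmP qmw]].
  apply/mnmP => i; case: (unliftP ord_max i) => [j ->|-> //].
  have := qmw j; rewrite !mnmE.
  suff -> : lift ord_max j = widen j by [].
  by apply: val_inj; rewrite /= /bump leqNgt ltn_ord.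
case: (m ord_max == _) => /=; last by rewrite !mulr0 mcoeff0.
by rewrite mulr1 mcoeffZ mcoeffX.
Qed.

Lemma horner_muni (R : comNzRingType) n (p : {mpoly R[n.+1]}) v x :
  (map_poly (meval v) (muni p)).[x] = p.@[fun i => oapp v x (unlift ord_max i)].
Proof.
rewrite muniE mevalE rmorph_sum horner_sum; apply: eq_bigr => m _.
rewrite -!mul_polyC !rmorphM /= !map_polyC /= map_polyXn !hornerE /=.
rewrite mevalZ mevalX big_ord_recr /= unlift_none /= mulrA; congr (_ * _ * _).
apply: eq_bigr => i _; rewrite mnmE; congr (_ ^+ _).
suff -> : widen i = lift ord_max i by rewrite liftK.
by apply: val_inj; rewrite /= /bump leqNgt ltn_ord.
Qed.

(** Induction on the number of variables: choose [v] where the leading coefficient in the last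
    variable does not vanish, then a nonroot of the resulting nonzero univariate polynomial. *)
Lemma meval_neq0 (k : closedFieldType) n (p : {mpoly k[n]}) :
  p != 0 -> exists v, p.@[v] != 0.
Proof.
elim: n p => [|n IHn] p p0.
  exists (fun=> 0); suff -> : p = (p@_0)%:MP.
    by rewrite mevalC; apply: contraNneq p0 => p0; apply/eqP/mpolyP => m;
       rewrite mcoeff0 (_ : m = 0%MM) //; apply/mnmP; case.
  by apply/mpolyP => m; rewrite mcoeffC (_ : m = 0%MM) ?eqxx ?mulr1 //; apply/mnmP; case.
have [v pv] : exists v, (lead_coef (muni p)).@[v] != 0.
  by apply: IHn; rewrite lead_coef_eq0 muni_eq0.
have /closed_nonrootP[x px] : map_poly (meval v) (muni p) != 0.
  by apply: contraNneq pv => pv; rewrite lead_coefE -coef_map pv coef0.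
by exists (fun i => oapp v x (unlift ord_max i)); rewrite -horner_muni.
Qed.

Lemma meval_scale (R : comNzRingType) n d (p : {mpoly R[n]}) c v :
  p \is d.-homog -> p.@[fun i => c * v i] = c ^+ d * p.@[v].
Proof.
move=> /dhomog_mf pd; rewrite !mevalE mulr_sumr !big_seq; apply: eq_bigr => m /pd <-.
rewrite mulrCA /= mdegE expr_sum -big_split /=; congr (_ * _).
by apply: eq_bigr => i _; rewrite exprMn.

Qed.

End Meval.

(** * Plane vectors and general points *)

Section Vectors.
Variable k : fieldType.
Implicit Types (u v w : 'rV[k]_3).

Definition dot u v := \sum_i u 0 i * v 0 i.

(** The usual cross product: indices in ['I_3] are added modulo 3. *)
Definition cross u v : 'rV[k]_3 :=
  \row_i (u 0 (i + 1) * v 0 (i + 2) - u 0 (i + 2) * v 0 (i + 1)).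

Lemma sum_ord3 (f : 'I_3 -> k) : \sum_i f i = f 0 + f 1 + f 2.
Proof.
by rewrite !big_ord_recl big_ord0 addr0 addrA; congr (f _ + f _ + f _); apply: val_inj.
Qed.

Lemma ord3P (P : 'I_3 -> Prop) : P 0 -> P 1 -> P 2 -> forall i, P i.
Proof.
move=> P0 P1 P2 [[|[|[|//]]] i]; [move: P0|move: P1|move: P2];
by congr P; apply: val_inj.
Qed.

Let add01 : (0 + 1 : 'I_3) = 1. Proof. exact: val_inj. Qed.
Let add02 : (0 + 2 : 'I_3) = 2. Proof. exact: val_inj. Qed.
Let add11 : (1 + 1 : 'I_3) = 2. Proof. exact: val_inj. Qed.
Let add12 : (1 + 2 : 'I_3) = 0. Proof. exact: val_inj. Qed.
Let add21 : (2 + 1 : 'I_3) = 0. Proof. exact: val_inj. Qed.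
Let add22 : (2 + 2 : 'I_3) = 1. Proof. exact: val_inj. Qed.
Let add3 := (add01, add02, add11, add12, add21, add22).

Lemma dot_crossl u v : dot (cross u v) u = 0.
Proof. by rewrite /dot sum_ord3 !mxE !add3; ring. Qed.

Lemma cross_eq0 u v i j : cross u v = 0 -> u 0 i * v 0 j = u 0 j * v 0 i.
Proof.
move=> /rowP uv0; have := (uv0 0, uv0 1, uv0 2).
rewrite !mxE !add3 => -[[/subr0_eq e0 /subr0_eq e1] /subr0_eq e2].
by elim/ord3P: i; elim/ord3P: j.
Qed.

(** [dot (cross u v) x] is the determinant of [u], [v], [x], which all lie in the plane orthogonal
    to [w]. *)
Lemma dot_cross_eq0 w u v x :
  w != 0 -> dot w u = 0 -> dot w v = 0 -> dot w x = 0 -> dot (cross u v) x = 0.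
Proof.
move=> w0 wu wv wx; apply: contraNeq w0 => /mulfI uvx.
apply/eqP/rowP => i; apply: uvx; rewrite mxE mulr0.
(* w (uv.x) = (u x v) (w.x) + x x (w x (u x v)), and w is orthogonal to u, v, x *)
have -> : dot (cross u v) x * w 0 i = cross u v 0 i * dot w x
    + cross x u 0 i * dot w v - cross x v 0 i * dot w u.
  by rewrite /dot !sum_ord3 !mxE; elim/ord3P: i; rewrite !add3; ring.
by rewrite wu wv wx !mulr0 !addr0 subr0.
Qed.

Lemma pivot_neq0 v : v != 0 -> v 0 (pivot v) != 0.
Proof.
move=> /rV0Pn[i vi]; rewrite /pivot; case: pickP => [j /andP[]//|] /=.
case: (arg_minnP (P := fun i => v 0 i != 0) (fun i => i : nat) vi) => j vj jmin /(_ j).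
rewrite vj => /negbT/forallPn[l]; rewrite negb_imply => /andP[lj /jmin].
by rewrite leqNgt lj.
Qed.

Lemma pivot_scale c v : c != 0 -> pivot (c *: v) = pivot v.
Proof.
move=> c0; rewrite /pivot; congr odflt; apply: eq_pick => i.
rewrite mxE mulf_eq0 (negPf c0); congr (_ && _); apply: eq_forallb => j.
by rewrite mxE mulf_eq0 (negPf c0).
Qed.

Lemma P2_normalize v : v != 0 -> exists (p : P2 k) c, c != 0 /\ val p = c *: v.
Proof.
move=> v0; have vp := pivot_neq0 v0; pose c := (v 0 (pivot v))^-1.
have c0 : c != 0 by rewrite invr_eq0.
have pP : (c *: v) 0 (pivot (c *: v)) == 1 by rewrite pivot_scale // mxE mulVf.
by exists (exist (fun v : 'rV_3 => v 0 (pivot v) == 1) _ pP), c.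
Qed.

End Vectors.

(** The product of [G] and the linear forms [dot w] is a nonzero polynomial, so it has a
    nonvanishing point; by homogeneity this survives normalization. *)
Lemma general_point (k : closedFieldType) d (G : dhomog 3 k d) (ws : seq 'rV[k]_3) :
  G != 0 -> 0 \notin ws ->
  exists2 p : P2 k, G.@[fun i => val p 0 i] != 0
    & forall w, w \in ws -> dot w (val p) != 0.
Proof.
move=> G0 ws0; pose lin (w : 'rV[k]_3) : {mpoly k[3]} := \sum_i w 0 i *: 'X_i.
have lin0 w : w \in ws -> lin w != 0.
  apply: contraTneq => /mpolyP lin0; suff -> : w = 0 by [].
  apply/rowP => j; have := lin0 U_(j)%MM; rewrite mcoeff0 mxE => <-.
  rewrite raddf_sum (bigD1 j) //= mcoeffZ mcoeffXU eqxx mulr1 big1 ?addr0 // => i ij.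
  by rewrite mcoeffZ mcoeffXU (negPf ij) mulr0.
(* the factor 'X_ord0 ensures that the point found is not the zero vector *)
have [|v] := @meval_neq0 k 3 ((G : {mpoly k[3]}) * 'X_ord0 * \prod_(w <- ws) lin w).
  rewrite !mulf_neq0 //; last by rewrite prodf_seq_neq0; apply/allP => w /lin0.
  by rewrite -msupp_eq0 msuppX.
rewrite !mevalM mevalXU !mulf_eq0 !negb_or rmorph_prod prodf_seq_neq0.
move=> /andP[/andP[Gv v0] /allP linv].
have [|p [c [c0 pE]]] := @P2_normalize k (\row_i v i).
  by apply: contraNneq v0 => /rowP /(_ 0); rewrite !mxE => ->.
exists p => [|w ws_w].
  rewrite (@meval_eq _ _ _ (fun i => c * v i)); last by move=> i; rewrite pE !mxE.
  by rewrite (meval_scale _ _ (dhomog_is_dhomog G)) mulf_neq0 ?expf_neq0.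
have := linv _ ws_w; rewrite raddf_sum.
have -> : dot w (val p) = c * \sum_i (w 0 i *: 'X_i).@[v].
  rewrite mulr_sumr; apply: eq_bigr => i _.
  by rewrite mevalZ mevalXU pE !mxE mulrCA.
exact: mulf_neq0.
Qed.

(** * Multiplicities and blow-up charts *)

Section Transforms.
Variable k : fieldType.
Implicit Types (f : {mpoly k[2]}) (c : option k) (x y : bubble k) (p : P2 k).

Lemma mult_eq0 f : f@_0 != 0 -> mult f = 0%N.
Proof.
rewrite -mcoeff_msupp => /mlast_lemc/lemc_mdeg.
by rewrite mdeg0 leqn0 => /eqP.
Qed.

Lemma mult_gt0 f : mult f != 0%N -> f@_0 = 0.
Proof. by move=> f0; apply/eqP; apply: contraNT f0 => /mult_eq0 ->. Qed.

Lemma mult_eq0E f : f != 0 -> mult f = 0%N -> f@_0 != 0.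
Proof.
move=> /mlast_supp; rewrite mcoeff_msupp => f0 /eqP.
by rewrite mdeg_eq0 => /eqP mf; rewrite mf in f0.
Qed.

Lemma mult0 : mult (0 : {mpoly k[2]}) = 0%N.
Proof. by rewrite /mult mlast0 mdeg0. Qed.

Lemma mult1 : mult (1 : {mpoly k[2]}) = 0%N.
Proof. by rewrite mult_eq0 // mcoeff1 eqxx oner_eq0. Qed.

Lemma multX i : mult ('X_i : {mpoly k[2]}) = 1%N.
Proof.
rewrite /mult (mlastE (m := U_(i)%MM)) ?mdeg1 ?msuppX ?mem_head // => m.
by rewrite inE => /eqP ->.
Qed.

Lemma div_var0 i f : div_var i 0 f = f.
Proof. by rewrite /div_var [RHS]mpolyE; apply: eq_bigr => m _; rewrite mulm0n subm0. Qed.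

(** Subtraction of exponents is truncated, so both monomials [0] and [U_(i)] are sent to [0]; the
    term [f@_0] comes from this. *)
Lemma mcoeff_div_var1 i f : (div_var i 1 f)@_0 = f@_0 + f@_U_(i).
Proof.
rewrite /div_var raddf_sum /= [in RHS](mpolyE f) !raddf_sum -big_split /=.
apply: eq_bigr => m _; rewrite !mcoeffZ !mcoeffX -mulrDr -natrD mulm1n; congr (_ * _%:R).
have [->|m0] := eqVneq m 0%MM; first by rewrite sub0m eqxx eq_sym mnm1_eq0.
rewrite add0n; congr (nat_of_bool _); apply/eqP/eqP => [/mnmP mi|->]; last first.
  by apply/mnmP => j; rewrite mnmBE subnn mnm0E.
have mj j : i != j -> m j = 0%N.
  by move=> /negPf ij; have := mi j; rewrite mnmBE mnm1E ij subn0 mnm0E.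
apply/mnmP => j; rewrite mnm1E; have [<-|/mj //] := eqVneq i j.
have := mi i; rewrite mnmBE mnm1E eqxx mnm0E => /eqP; rewrite subn_eq0.
case: (posnP (m i)) => [mi0 _|]; last by case: (m i) => [|[]].
case/eqP: m0; apply/mnmP => l; rewrite mnm0E.
by have [<-|/mj] := eqVneq i l.
Qed.

Lemma comp_mpoly_mcoeff0 (R : comNzRingType) n m (p : {mpoly R[n]})
    (q : n.-tuple {mpoly R[m]}) :
  (forall i, (tnth q i)@_0 = 0) -> (p \mPo q)@_0 = p@_0.
Proof.
move=> q0; rewrite comp_mpolyEX [in RHS](mpolyE p) !raddf_sum /=.
apply: eq_bigr => a _; rewrite !mcoeffZ comp_mpolyX; congr (_ * _).
rewrite rmorph_prod /= mcoeffX; have [->|] := eqVneq a 0%MM.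
  by rewrite big1 // => i _; rewrite mnm0E expr0 mcoeff1 eqxx.
rewrite -mdeg_eq0 mdegE sum_nat_eq0 => /forallPn[i /= ai].
by rewrite (bigD1 i) //= rmorphXn /= q0 expr0n (negPf ai) mul0r.
Qed.

Lemma blowup_chart_mcoeff0 c i : (tnth (blowup_chart c) i)@_0 = 0.
Proof.
have X0 (j : 'I_2) : ('X_j : {mpoly k[2]})@_0 = 0 by rewrite mcoeffX mnm1_eq0.
by case: c => [a|]; rewrite /blowup_chart !(tnth_nth 0); case: i => -[|[|//]] i /=;
   rewrite ?rmorphM /= ?X0 ?mul0r.
Qed.

(** A curve missing a point misses the points infinitely near it: substituting the chart preserves
    the constant term. For [f = 0] the convention [mult 0 = 0] is used. *)
Lemma mult_strict_step0 c f : mult f = 0%N -> mult (strict_step c f) = 0%N.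
Proof.
move=> f0; rewrite /strict_step f0 div_var0 /total_step.
have [->|/mult_eq0E/(_ f0)] := eqVneq f 0; first by rewrite comp_mpoly0 mult0.
by rewrite -(comp_mpoly_mcoeff0 _ (blowup_chart_mcoeff0 c)) => /mult_eq0.
Qed.

Lemma strict_step1 c : strict_step c 1 = 1.
Proof. by rewrite /strict_step mult1 div_var0 /total_step comp_mpoly1. Qed.

End Transforms.

(** * Lines through infinitely near points *)

Section Lines.
Variable k : fieldType.
Implicit Types (f : {mpoly k[2]}) (c : option k) (x y : bubble k) (p : P2 k).

Fixpoint base x : P2 k :=
  match x with Proper p => p | Near y _ => base y end.

(** The tangent direction at [base x] over which an infinitely near [x] lies; [None] at a proper
    point is a default value. *)
Fixpoint direction x : option k :=
  match x with
  | Proper _ => None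
  | Near (Proper _) c => c
  | Near y _ => direction y
  end.

(** The vector (1, a) for [Some a] and (0, 1) for [None], read off from the chart as coefficients of
    the exceptional variable and placed in the coordinates other than the pivot. *)
Definition tangent p c : 'rV[k]_3 :=
  \row_i (if unlift (pivot (val p)) i is Some r
          then (tnth (blowup_chart c) r)@_U_(exc_var c) else 0).

Definition coefs (F : dhomog 3 k 1) : 'rV[k]_3 := \row_i F@_U_(i).

Lemma form1E (F : dhomog 3 k 1) : F = \sum_i coefs F 0 i *: 'X_i :> {mpoly k[3]}.
Proof.
apply/mpolyP => m; rewrite raddf_sum /=; under eq_bigr do rewrite mcoeffZ mcoeffX mxE.
have [/eqP/mdeg1P[j /eqP->]|m1] := eqVneq (mdeg m) 1%N.
  rewrite (bigD1 j) //= eqxx mulr1 big1 ?addr0 // => i ij.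
  by rewrite eq_mnm1 (negPf ij) mulr0.
rewrite (dhomog_nemf_coeff (dhomog_is_dhomog F) m1) big1 // => i _.
by have [mE|_] := eqVneq; rewrite ?mulr0 //; rewrite -mE mdeg1 in m1.
Qed.

Lemma coefs_eq0 F : (coefs F == 0) = (F == 0).
Proof.
apply/eqP/eqP => [F0|->]; last by apply/rowP => i; rewrite !mxE mcoeff0.
by apply: val_inj; rewrite /= form1E F0 big1 // => i _; rewrite mxE scale0r.
Qed.

Lemma tangent_neq0 p c :
  exists2 j, tangent p c 0 j != 0 & tangent p c 0 (pivot (val p)) = 0.
Proof.
exists (lift (pivot (val p)) (exc_var c)); last by rewrite mxE unlift_none.
rewrite mxE liftK; case: c => [a|] /=; rewrite (tnth_nth 0) /=.
  by rewrite mcoeffXU eqxx oner_eq0.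
by rewrite mcoeffXU eqxx oner_eq0.
Qed.

Lemma total_form1 (F : dhomog 3 k 1) p :
  F \mPo affine_chart p = (dot (coefs F) (val p))%:MP
    + \sum_i coefs F 0 i *: (if unlift (pivot (val p)) i is Some r then 'X_r else 0).
Proof.
rewrite [in LHS]form1E raddf_sum /dot rmorph_sum -big_split; apply: eq_bigr => i _ /=.
rewrite comp_mpolyZ comp_mpolyXU -tnth_nth tnth_mktuple scalerDr; congr (_ + _).
by rewrite -mul_mpolyC -mpolyCM.
Qed.

(* A line is smooth, so it passes through a point infinitely near [base y] only
   if it contains [base y] and is tangent there to [direction y]. *)
Lemma line_near (F : dhomog 3 k 1) y c (x := Near y c) :
  mult (strict F x) != 0%N ->
  dot (coefs F) (val (base x)) = 0
  /\ dot (coefs F) (tangent (base x) (direction x)) = 0.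
Proof.
rewrite {}/x; elim: y c => [p|y IH d] c; last first.
  (* If the point below is itself infinitely near, it has the same [base] and [direction], and the
     line passes through it too. *)
  move=> Fx; apply: (IH d); apply: contraNneq Fx => Fx /=.
  by rewrite mult_strict_step0.
have Ef := total_form1 F p; set f := _ \mPo _ in Ef; rewrite /= -/f => sf.
have f_gt0 : mult f != 0%N by apply: contraNneq sf => /(mult_strict_step0 c) ->.
pose Y i : {mpoly k[2]} := if unlift (pivot (val p)) i is Some r then 'X_r else 0.
have Ym m i : mdeg m != 1%N -> (Y i)@_m = 0.
  rewrite /Y; case: unlift => [r|]; last by rewrite mcoeff0.
  by rewrite mcoeffX => m1; case: eqP => [rm|//]; rewrite -rm mdeg1 in m1.
have f0 := mult_gt0 f_gt0; have Fp : dot (coefs F) (val p) = 0.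
  move: f0; rewrite Ef mcoeffD mcoeffC eqxx mulr1 raddf_sum /= big1 ?addr0 // => i _.
  by rewrite mcoeffZ (Ym 0%MM) ?mulr0 ?mdeg0.
split=> //; rewrite Fp mpolyC0 add0r in Ef.
(* [f] has only linear terms left, and it is nonzero because [mult 0] is 0. *)
have f1 : mult f = 1%N.
  have /mlast_supp : f != 0 by apply: contraNneq f_gt0 => ->; rewrite mult0.
  rewrite mcoeff_msupp /mult; move: (mlast f) => m; apply: contraNeq => /Ym Yf.
  by rewrite Ef raddf_sum /= big1 // => i _; rewrite mcoeffZ Yf mulr0.
(* The total transform is divided once by the exceptional equation, so the vanishing constant term
   of the quotient is the coefficient of the exceptional variable, that is, the value of the line on
   [tangent]. *)
have := mult_gt0 sf; rewrite /strict_step f1 mcoeff_div_var1 /total_step.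
rewrite comp_mpoly_mcoeff0 ?f0 ?add0r; last exact: blowup_chart_mcoeff0.
rewrite Ef (raddf_sum (comp_mpoly _)) raddf_sum /= => sf0.
rewrite -[RHS]sf0; apply: eq_bigr => i _.
rewrite comp_mpolyZ mcoeffZ [X in _ * X]mxE; congr (_ * _).
by case: unlift => [r|]; rewrite ?comp_mpolyXU -?tnth_nth // comp_mpoly0 mcoeff0.
Qed.

(** Coefficients of the line through [base x] with tangent direction [direction x], the default one
    if [x] is proper. *)
Definition line_at x := cross (val (base x)) (tangent (base x) (direction x)).

(** The two factors are independent: the pivot coordinate is 1 on the base point and 0 on the
    nonzero tangent vector. *)
Lemma line_at_neq0 x : line_at x != 0.
Proof.
have [j tj tp] := tangent_neq0 (base x) (direction x).
apply: contra_neq tj => /(@cross_eq0 _ _ _ (pivot (val (base x))) j).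
by rewrite tp mulr0 (eqP (valP (base x))) mul1r.
Qed.

Lemma line_at_base x : dot (line_at x) (val (base x)) = 0.
Proof. exact: dot_crossl. Qed.

(** The base point, the tangent vector and [p] are all orthogonal to the nonzero vector [coefs F],
    hence linearly dependent. *)
Lemma line_at_unique (F : dhomog 3 k 1) y c p :
  F != 0 -> mult (strict F (Near y c)) != 0%N -> mult (strict F (Proper p)) != 0%N ->
  dot (line_at (Near y c)) (val p) = 0.
Proof.
rewrite -coefs_eq0 => F0 /line_near[Fx Ft] /mult_gt0 Fp.
apply: dot_cross_eq0 F0 Fx Ft _; rewrite -[RHS]Fp /= [in RHS]total_form1.
rewrite mcoeffD mcoeffC eqxx mulr1 raddf_sum /= big1 ?addr0 // => i _.
by rewrite mcoeffZ; case: unlift => [r|]; rewrite ?mcoeff0 ?mcoeffX ?mnm1_eq0 mulr0.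
Qed.

End Lines.

(** * Infinitely near points and classes of curves *)

Section Centers.
Variable k : fieldType.
Implicit Types (b x y : bubble k).

Fixpoint lies_over b x : bool := if x is Near y _ then (y == b) || lies_over b y else false.

Fixpoint height x : nat := if x is Near y _ then (height y).+1 else 0.

Lemma lies_over_height b x : lies_over b x -> (height b < height x)%N.
Proof. by elim: x => //= y IH _ /orP[/eqP->|/IH/ltnW]. Qed.

Lemma strict_exc_not_lies_over b x : ~~ lies_over b x -> strict_exc b x = 1.
Proof.
by elim: x => //= y IH c; rewrite negb_or => /andP[/negPf -> /IH ->]; rewrite strict_step1.
Qed.

Lemma lies_over_base p x : lies_over (Proper p) x -> base x = p.
Proof. by elim: x => //= y IH _ /orP[/eqP->|/IH]. Qed.

(** Once blown up, a point is no longer a point of the later surfaces. *)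
Lemma centers_inj n (s : n.-tuple (bubble k)) : centers s -> injective (tnth s).
Proof.
move=> sP; have lt_neq (i j : 'I_n) : (i < j)%N -> tnth s i <> tnth s j.
  move=> ij sij; have /andP[/negP[]] := sP j.
  rewrite -sij (tnth_nth (tnth s i)) -(@nth_take j) // mem_nth //.
  by rewrite size_takel ?size_tuple // ltnW.
move=> i j sij; apply: val_inj.
by have [/lt_neq/(_ sij)|/lt_neq/(_ (esym sij))|] := ltngtP i j.
Qed.

Lemma lies_over_Near x c y : lies_over (Near x c) y -> lies_over x y.
Proof. by elim: y => //= y IH _ /orP[/eqP->|/IH ->]; rewrite /= ?eqxx ?orbT. Qed.

End Centers.

Section Classes.
Variables (k : fieldType) (n : nat).
Implicit Types (s : n.-tuple (bubble k)) (i j : 'I_n).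

Lemma Pic_coefB (D E : Pic n) i : (D - E).2 0 i = D.2 0 i - E.2 0 i.
Proof. by rewrite !mxE. Qed.

Lemma Pic_coef_sum (m : 'I_n -> nat) j : (\sum_(i < n) exc i *+ m i).2 0 j = (m j)%:Z.
Proof.
rewrite (raddf_sum snd) summxE (bigD1 j) //= big1 => [|i ij].
  by rewrite addr0 raddfMn /= mulmxnE mxE !eqxx; exact: natz.
by rewrite raddfMn /= mulmxnE mxE eqxx eq_sym (negPf ij) mul0rn.
Qed.

Lemma Pic_deg_sum (m : 'I_n -> nat) : (\sum_(i < n) exc i *+ m i).1 = 0.
Proof. by rewrite (raddf_sum fst) big1 // => i _; rewrite raddfMn /= mul0rn. Qed.

Lemma exc_coef i j : (exc i).2 0 j = (j == i)%:Z.
Proof. by rewrite mxE eqxx natz. Qed.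

Lemma plane_class_deg s t (F : dhomog 3 k t) : (plane_class s F).1 = t%:Z.
Proof.
rewrite /plane_class (raddfB fst) /= Pic_deg_sum subr0 raddfMn /=.
exact: natz.
Qed.

Lemma plane_class_coef s t (F : dhomog 3 k t) j :
  (plane_class s F).2 0 j = - (mult (strict F (tnth s j)))%:Z.
Proof. by rewrite Pic_coefB Pic_coef_sum raddfMn /= mulmxnE mxE mul0rn sub0r. Qed.

Lemma exc_class_deg s j : (exc_class s j).1 = 0.
Proof. by rewrite /exc_class (raddfB fst) /= Pic_deg_sum subr0. Qed.

Lemma exc_class_coef s i j :
  (exc_class s j).2 0 i = (i == j)%:Z - (mult (strict_exc (tnth s j) (tnth s i)))%:Z.
Proof. by rewrite Pic_coefB Pic_coef_sum exc_coef. Qed.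

(** A plane curve of degree 0 would be a constant, so the class is that of an exceptional curve. Its
    only possible positive coefficient identifies this curve as the one over point [i]; the
    coefficient -1 at [j] makes its strict transform pass through point [j]. *)
Lemma minus_two_exc s i j :
  minus_two_class s (exc i - exc j) -> lies_over (tnth s i) (tnth s j).
Proof.
move=> [D2 D22]; have ij : i != j.
  apply: contra_eqN D22 => /eqP ->; rewrite subrr /selfint expr0n sub0r.
  by rewrite big1 // => l _; rewrite mxE expr0n.
case: D2 => [[t [F Firr FE]]|[l lE]].
  have t0 : t = 0%N.
    have := plane_class_deg s F; rewrite -FE (raddfB fst) /= subr0 => - [<-] //.
  rewrite {}t0 in F Firr {FE}; have [F0 /negP[]] := Firr.
  have FC : (F : {mpoly k[3]}) = (F@_0)%:MP.
    apply/mpolyP => m; rewrite mcoeffC; have [->|m0] := eqVneq m 0%MM; first by rewrite mulr1.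
    by rewrite mulr0 (dhomog_nemf_coeff (dhomog_is_dhomog F)) ?mdeg_eq0.
  rewrite FC rmorph_unit // unitfE.
  by apply: contraNneq F0 => F0; rewrite FC F0 mpolyC0.
have lcoef m : ((m == i)%:Z - (m == j)%:Z) =
    (m == l)%:Z - (mult (strict_exc (tnth s l) (tnth s m)))%:Z.
  by rewrite -exc_class_coef -lE Pic_coefB !exc_coef.
have il : i = l.
  have := lcoef i; rewrite eqxx (negPf ij) subr0.
  by case: eqVneq => // _; case: (mult _).
have := lcoef j; rewrite -il eqxx eq_sym (negPf ij) !sub0r.
by apply: contra_eqT => /strict_exc_not_lies_over ->; rewrite mult1.
Qed.

(** The exceptional curve has multiplicity 1 at the point [b] directly above [a] and contains no
    other center, so just [exc b] is subtracted; the self-intersection is -1 - 1. *)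
Lemma exc_class_near s a b :
  centers s -> (forall i, lies_over (tnth s a) (tnth s i) -> i = b) ->
  (exists c, tnth s b = Near (tnth s a) c) ->
  minus_two_class s (exc a - exc b).
Proof.
move=> sP ab [c sb].
have exE : exc_class s a = exc a - exc b.
  congr (_ - _); rewrite (bigD1 b) //= sb /= eqxx multX mulr1n big1 ?addr0 // => i ib.
  rewrite strict_exc_not_lies_over ?mult1 //; apply: contraNN ib => /ab ->; exact: eqxx.
split; first by right; exists a.
have ba : b != a.
  apply/eqP => ba; have /(congr1 (@height k)) := sb; rewrite ba => /eqP.
  by rewrite /= eqn_leq ltnn andbF.
rewrite /selfint (_ : (exc a - exc b).1 = 0) // expr0n sub0r (bigD1 a) // (bigD1 b) //.
rewrite big1 => [|i /andP[/andP[_ /negPf ia] /negPf ib]];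
  rewrite Pic_coefB !exc_coef ?ia ?ib //.
by rewrite Pic_coefB !exc_coef !eqxx eq_sym (negPf ba).
Qed.

End Classes.

(** * The classes e_a - e_b in the seven types *)

Section Types.

Lemma exc_sub_inj n (a b i j : 'I_n) :
  a != b -> exc a - exc b = exc i - exc j -> a = i /\ b = j.
Proof.
move=> /negPf ab E; have coef m : ((m == a)%:Z - (m == b)%:Z) = ((m == i)%:Z - (m == j)%:Z).
  by rewrite -!exc_coef -!Pic_coefB E.
split; apply/eqP.
  by have := coef a; rewrite eqxx ab; case: (a == i) (a == j) => -[].
by have := coef b; rewrite eqxx eq_sym ab; case: (b == i) (b == j) => -[].
Qed.

Lemma ell_deg n : (ell n).1 = 1. Proof. by []. Qed.
Lemma exc_deg n (i : 'I_n) : (exc i).1 = 0. Proof. by []. Qed.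
Lemma antican_deg n : (antican n).1 = 3.
Proof. by rewrite (raddfB fst) (raddf_sum fst) /= big1. Qed.

Lemma Pic_degB n (D E : Pic n) : (D - E).1 = D.1 - E.1. Proof. by []. Qed.
Lemma Pic_degD n (D E : Pic n) : (D + E).1 = D.1 + E.1. Proof. by []. Qed.
Lemma Pic_degMn n (D : Pic n) m : (D *+ m).1 = D.1 *+ m. Proof. exact: (raddfMn fst). Qed.

Let degE := (Pic_degB, Pic_degD, Pic_degMn, ell_deg, antican_deg, exc_deg).

Lemma ell_coef n (j : 'I_n) : (ell n).2 0 j = 0. Proof. by rewrite mxE. Qed.

Lemma eq_inord n i j : (i <= n)%N -> (j <= n)%N ->
  (inord i == inord j :> 'I_n.+1) = (i == j).
Proof. by move=> ni nj; rewrite -val_eqE /= !inordK. Qed.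

(** The obstructions to [a] being the index of a general [P] and [b] that of the only center over
    it: [P] over another center, a center over point [b], or a line through [P] and a center [j],
    other than [b], that is infinitely near some [i]. *)
Variant linked (T : seq (Pic 9)) (a b : 'I_9) : Prop :=
  | LinkedBefore c of exc c - exc a \in T
  | LinkedAfter c of exc b - exc c \in T
  | LinkedLine i j D of exc i - exc j \in T & D \in T & j != b
      & D.1 = 1 & D.2 0 a != 0 & D.2 0 j != 0.

(** Classes of nonzero degree are discarded; each remaining entry of the list fixes [a] and [b]. *)
Ltac split_mem ab :=
  rewrite !inE; repeat (case/orP; [|]);
  try (by move=> /eqP/(congr1 fst); rewrite !degE); move=> /eqP/(exc_sub_inj ab)[-> ->].

(* The numerals are positions in the list, counted from 0. *)
Ltac before T n := exact: (LinkedBefore _ (@mem_nth _ 0 T n isT)).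
Ltac after T n := exact: (LinkedAfter _ (@mem_nth _ 0 T n isT)).
Ltac on_line T n m :=
  apply: (LinkedLine (@mem_nth _ 0 T n isT) (@mem_nth _ 0 T m isT));
  by rewrite ?eq_inord // !Pic_coefB ell_coef !exc_coef !eq_inord.

Lemma type_ii_linked a b : a != b -> exc a - exc b \in type_ii -> linked type_ii a b.
Proof.
move=> ab; split_mem ab.
(* The pairs (1, 2), (3, 4), (5, 6) are linked cyclically: a line joins the first point of each to
   both points of the next. *)
- on_line type_ii 4%N 2%N.
- on_line type_ii 7%N 5%N.
- on_line type_ii 0%N 6%N.
- before type_ii 11%N.
- after type_ii 10%N.
Qed.

(** In types (iii), (iv), (v) and (vii) every class e_i - e_j has a neighbour in a chain of such
    classes. *)
Lemma type_iii_linked a b : a != b -> exc a - exc b \in type_iii -> linked type_iii a b.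
Proof.
move=> ab; split_mem ab.
- before type_iii 2%N.
- after type_iii 0%N.
- after type_iii 5%N.
- before type_iii 4%N.
- before type_iii 11%N.
- after type_iii 10%N.
Qed.

Lemma type_iv_linked a b : a != b -> exc a - exc b \in type_iv -> linked type_iv a b.
Proof.
move=> ab; split_mem ab.
- before type_iv 4%N.
- after type_iv 3%N.
- after type_iv 7%N.
- before type_iv 6%N.
- after type_iv 9%N.
- before type_iv 8%N.
Qed.

Lemma type_v_linked a b : a != b -> exc a - exc b \in type_v -> linked type_v a b.
Proof.
move=> ab; split_mem ab.
- after type_v 1%N.
- before type_v 0%N.
- after type_v 4%N.
- before type_v 3%N.
- before type_v 4%N.
- before type_v 5%N.
- before type_v 8%N.
Qed.

Lemma type_vi_linked a b : a != b -> exc a - exc b \in type_vi -> linked type_vi a b.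
Proof.
move=> ab; split_mem ab.
(* The lines through 6, 8, 9 and through 1, 2, 8 serve the pairs (6, 7) and (8, 9); the other pairs
   form the chain from 1 to 5. *)
- on_line type_vi 7%N 1%N.
- before type_vi 4%N.
- before type_vi 5%N.
- before type_vi 8%N.
- on_line type_vi 8%N 6%N.
- after type_vi 5%N.
Qed.

Lemma type_vii_linked a b : a != b -> exc a - exc b \in type_vii -> linked type_vii a b.
Proof.
move=> ab; split_mem ab.
- after type_vii 1%N.
- before type_vii 0%N.
- before type_vii 1%N.
- before type_vii 2%N.
- before type_vii 3%N.
- before type_vii 4%N.
- before type_vii 5%N.
- before type_vii 6%N.
Qed.

Lemma types_linked T a b :
  T \in quasi_elliptic_types -> a != b -> exc a - exc b \in T -> linked T a b.
Proof.
move=> + ab; rewrite !inE => /or4P[/eqP->|/eqP->|/eqP->|/or4P[]/eqP->].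
(* Type (i) consists of classes of degree 1 only. *)
- by split_mem ab.
- exact: type_ii_linked.
- exact: type_iii_linked.
- exact: type_iv_linked.
- exact: type_v_linked.
- exact: type_vi_linked.
- exact: type_vii_linked.
Qed.

End Types.

(** * Choice of P off the lines attached to Z, and the contradiction *)

Theorem theorem1 (k : closedFieldType) (char3 : 3%N \in [pchar k]) :
  ~ exists Z : 7.-tuple (bubble k),
      [/\ centers Z,
          admits_unexpected Z 2
        & general (fun P : P2 k =>
            exists c : option k,
              let Y := [tuple of rcons Z (Proper P)] in
              let X := [tuple of rcons Y (Near (Proper P) c)] in
              quasi_elliptic X (containing Y 3)
              /\ exists2 T, T \in quasi_elliptic_types & has_type X T)].
Proof.
case=> Z [_ _ [d [G G0 GQ]]].
have lines0 : 0 \notin [seq line_at x | x <- Z].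
  by apply/mapP => -[x _ /esym/eqP]; rewrite (negPf (line_at_neq0 x)).
have [p Gp Zp] := general_point G0 lines0.
have {GQ}[c [_ [T T_type [s [sX sP sT]]]]] := GQ p Gp.
have {}Zp x : x \in Z -> dot (line_at x) (val p) != 0.
  by move=> Zx; apply/Zp/map_f.
have mem_s x : (x \in s) = [|| x == Near (Proper p) c, x == Proper p | x \in Z].
  by rewrite (perm_mem sX) /= !(mem_rcons, inE).
(* The indices in the list of the type refer to the reordering [s], so the two points over and at
   [P] are located there. *)
have /tnthP[a sa] : Proper p \in s by rewrite mem_s eqxx orbT.
have /tnthP[b sb] : Near (Proper p) c \in s by rewrite mem_s eqxx.
(* A point of [Z] over [P] would have base [P], but its [line_at] passes through its base and avoids
   [P]. *)
have s_over i : lies_over (Proper p) (tnth s i) -> i = b.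
  have := mem_tnth i s; rewrite mem_s => /or3P[/eqP si _|/eqP-> //|Zi /lies_over_base pi].
    by apply: (centers_inj sP); rewrite si.
  by have := Zp _ Zi; rewrite -pi line_at_base eqxx.
have ab : a != b by apply/eqP => ab; move: sb; rewrite -ab -sa.
have Tab : exc a - exc b \in T.
  by apply/sT/exc_class_near; rewrite // -?sa -?sb //; exists c.
have [i /sT/minus_two_exc|i /sT/minus_two_exc|i j D] := types_linked T_type ab Tab.
- by rewrite -sa.
- rewrite -sb => bi; have ib := s_over _ (lies_over_Near bi).
  by move/lies_over_height: bi; rewrite ib -sb ltnn.
(* Having degree 1, [D] is the class of a line [F], which passes through [P] and through the center
   [j]. *)
move=> /sT/minus_two_exc ij /sT[[[t [F [F0 _ _] DF]]|[l ->]] _] jb;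
  last by rewrite exc_class_deg.
rewrite DF plane_class_deg !plane_class_coef !oppr_eq0 => -[t1].
rewrite {}t1 in F F0 {DF} *; rewrite -sa => Fa Fj.
(* As [j] differs from [b] and is infinitely near, it belongs to [Z]; then [F] forces [P] onto the
   [line_at] of this point. *)
have := mem_tnth j s; rewrite mem_s => /or3P[/eqP sj|/eqP sj|Zj].
- by case/eqP: jb; apply: (centers_inj sP); rewrite sj.
- by rewrite sj in ij.
move: ij Fj Zj; case: (tnth s j) => // y e _ Fj /Zp.
by rewrite (line_at_unique (F := F)) ?eqxx.
Qed.
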